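(* There exists $m_0$ such that for every $m\ge m_0$, in the Ulam–Rényi game over $\{0,\dots,2^m-1\}$ with at most $3$ lies there exists a perfect strategy all of whose questions are $4$-interval questions; moreover, all states of the game occurring in this strategy are well-shaped.
   Context: Game: Responder picks $x\in\mathcal U=\{0,\dots,2^m-1\}$; Questioner asks questions ''$x\in Q$?'' with $Q\subseteq\mathcal U$; Responder may lie at most 3 times. A state is a map $\sigma:\mathcal U\to\{0,1,2,3,4\}$ (number of answers falsified by each element, truncated at 4); the initial state is identically $0$; after question $Q$, $\sigma_{yes}(y)=\min\{\sigma(y)+[y\notin Q],4\}$, $\sigma_{no}(y)=\min\{\sigma(y)+[y\in Q],4\}$. A state is final if its support $\Sigma=\{y:\sigma(y)<4\}$ has at most one element. A strategy of size $q$ is a complete binary tree of depth $q$ with internal nodes labelled by questions, edges by answers; it is winning if the state at every leaf (obtained from the initial state by the root-to-leaf questions/answers) is final. $N_{\min}(2^m,3)=\min\{q: 2^{q-m}\ge\sum_{i=0}^3\binom qi\}$; a perfect strategy is a winning strategy of size $N_{\min}(2^m,3)$. An interval is $\emptyset$ or $\{x\in\mathcal U:a\le x\le b\}$; a 4-interval question is a union of at most 4 intervals. Well-shaped: order $\Sigma$ cyclically by the natural order of $\mathcal U$; $\mathcal L^\sigma$ is the minimum-length cyclic list of possibly empty arcs (consecutive blocks of $\Sigma$, each on a single level $\sigma(\cdot)$) partitioning $\Sigma$ with cyclically consecutive arcs on levels differing by exactly 1; $\sigma$ is well-shaped iff $\mathcal L^\sigma$ has exactly $2i+1$ arcs on level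 $i$ for $i=0,1,2$ and exactly 3 arcs on level 3.
   Formalization: ''Well-shaped'' is taken to mean that some cyclic list of possibly empty arcs with the required numbers of arcs per level exists, not that the minimum-length list has these numbers; with the minimum-length list the initial state itself would not be well-shaped. *)

(* Defs.v *)
From mathcomp Require Import all_boot.
Set Implicit Arguments. Unset Strict Implicit. Unset Printing Implicit Defensive.

(* A state: sigma : U -> {0,...,4} (number of falsified answers, truncated at 4). *)
Definition state (n : nat) := {ffun 'I_n -> nat}.

Definition init_state (n : nat) : state n := [ffun _ => 0].

Definition upd_yes n (s : state n) (Q : {set 'I_n}) : state n :=
  [ffun y => minn (s y + (y \notin Q)) 4].
Definition upd_no n (s : state n) (Q : {set 'I_n}) : state n :=
  [ffun y => minn (s y + (y \in Q)) 4].

Definition support n (s : state n) : {set 'I_n} := [set y | s y < 4].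
Definition final n (s : state n) : Prop := #|support s| <= 1.

(* Strategies: binary trees whose internal nodes are labelled by questions;
   Node Q t_yes t_no. *)
Inductive strategy (n : nat) :=
| Leaf
| Node of {set 'I_n} & strategy n & strategy n.
Arguments Leaf {n}.

Fixpoint complete_of_depth n (q : nat) (t : strategy n) : Prop :=
  match t, q with
  | Leaf, 0 => True
  | Node _ ty tn, q'.+1 => complete_of_depth q' ty /\ complete_of_depth q' tn
  | _, _ => False
  end.

Fixpoint leaves_final n (s : state n) (t : strategy n) : Prop :=
  match t with
  | Leaf => final s
  | Node Q ty tn => leaves_final (upd_yes s Q) ty /\ leaves_final (upd_no s Q) tn
  end.

Definition winning n (t : strategy n) : Prop := leaves_final (init_state n) t.

Fixpoint all_states n (P : state n -> Prop) (s : state n) (t : strategy n) : Prop :=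
  P s /\
  match t with
  | Leaf => True
  | Node Q ty tn => all_states P (upd_yes s Q) ty /\ all_states P (upd_no s Q) tn
  end.

Fixpoint all_questions n (P : {set 'I_n} -> Prop) (t : strategy n) : Prop :=
  match t with
  | Leaf => True
  | Node Q ty tn => P Q /\ all_questions P ty /\ all_questions P tn
  end.

(* An interval is empty or {x : a <= x <= b}; a k-interval question is a union
   of at most k intervals (taking a > b gives the empty interval). *)
Definition is_interval n (I : {set 'I_n}) : Prop :=
  exists a b : nat, I = [set x : 'I_n | a <= x <= b].

Definition four_interval_question n (Q : {set 'I_n}) : Prop :=
  exists I : 'I_4 -> {set 'I_n},
    (forall i, is_interval (I i)) /\ Q = \bigcup_(i < 4) I i.

(* Volume bound and N_min(2^m, 3): the least q with
   2^(q-m) >= sum_{i<=3} binom(q,i), i.e. (in nat) 2^m * sum <= 2^q. *)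
Definition volume_ok (m q : nat) : Prop :=
  2 ^ m * (\sum_(i < 4) 'C(q, i)) <= 2 ^ q.

Definition is_Nmin (m q : nat) : Prop :=
  volume_ok m q /\ forall q', volume_ok m q' -> q <= q'.

(* Well-shaped states.  Sigma is ordered cyclically starting from a point r;
   the position of x in that cyclic order is (x + n - r) mod n.
   A cyclic list of (possibly empty) arcs is given by the list [ls] of their
   levels together with a nondecreasing (w.r.t. the cyclic order) assignment
   [a] of the elements of Sigma to arcs; arc j consists of the elements
   assigned to j, all of which must be on level nth ls j. *)
Definition cyc_pos n (r x : 'I_n) : nat := (x + n - r) %% n.

Definition adjacent_levels (l l' : nat) : bool := (l == l'.+1) || (l' == l.+1).

Definition well_shaped n (s : state n) : Prop :=
  exists (r : 'I_n) (ls : seq nat) (a : 'I_n -> nat),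
    (
        forall x y, s x < 4 -> s y < 4 -> cyc_pos r x <= cyc_pos r y -> a x <= a y) /\
        (forall x, s x < 4 -> a x < size ls /\ nth 0 ls (a x) = s x) /\
        (forall j, j < size ls ->
          adjacent_levels (nth 0 ls j) (nth 0 ls (j.+1 %% size ls))) /\
        all (fun l => l <= 3) ls /\
        (forall i, i < 3 -> count_mem i ls = 2 * i + 1) /\
        count_mem 3 ls = 3.

(* Main.v *)
Require Import Defs.
From mathcomp Require Import all_boot zify.
Set Implicit Arguments. Unset Strict Implicit. Unset Printing Implicit Defensive.

(** A state is determined, as far as the rest of the game is concerned, by the
    cyclic list of the levels of its live elements.  Every state that occurs is a
    list of ten arcs on the levels 0 1 2 3 1 3 2 3 2 1 (or the reversed word),
    some of them possibly empty.  A question cuts each arc at most once.  A finite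
    set of 42 patterns of cuts, each with at most four intervals and each leading
    to such states for both answers, is rich enough to put into the question half
    of the levels 0, 1 and 2, with any rounding, together with any prescribed
    number between one third and two thirds of the elements of level 3; when at
    most one element has level below 3, that number is even arbitrary.

    Starting from the initial state, exact halving leads after [m] questions to a
    state with level sizes [1, m, 'C(m, 2), 'C(m, 3)].  The elements of level 3 are
    now so numerous that they can compensate the rounding errors of the lower
    levels and split the volume evenly for about [2 log m] further questions.
    After that at most one element has level below 3, and the remaining game is
    won by balancing the volume as far as possible. *)

(** * Run-length encoded lists and rotations *)

Fixpoint runs (T : Type) (w : seq T) (s : seq nat) : seq T :=
  match w, s with
  | x :: w', k :: s' => nseq k x ++ runs w' s'
  | _, _ => [::]
  end.

Lemma size_runs (T : Type) (w : seq T) s :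
  size s = size w -> size (runs w s) = sumn s.
Proof.
elim: w s => [|x w IHw] [|k s] //= [sz_s].
by rewrite size_cat size_nseq IHw.
Qed.

Lemma map_runs (T U : Type) (f : T -> U) w s :
  map f (runs w s) = runs (map f w) s.
Proof. by elim: w s => [|x w IHw] [|k s] //=; rewrite map_cat map_nseq IHw. Qed.

Lemma zip_nseq (T U : Type) k (x : T) (y : U) :
  zip (nseq k x) (nseq k y) = nseq k (x, y).
Proof. by elim: k => //= k ->. Qed.

Lemma zip_runs (T U : Type) (w : seq T) (v : seq U) s :
  zip (runs w s) (runs v s) = runs (zip w v) s.
Proof.
elim: w v s => [|x w IHw] [|y v] [|k s] //=; try by case: (_ ++ _).
by rewrite zip_cat ?size_nseq // zip_nseq IHw.
Qed.

Lemma runs_cat (T : Type) (w1 w2 : seq T) s1 s2 :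
  size s1 = size w1 -> runs (w1 ++ w2) (s1 ++ s2) = runs w1 s1 ++ runs w2 s2.
Proof.
elim: w1 s1 => [|x w1 IHw] [|k s1] //= [sz_s].
by rewrite IHw // catA.
Qed.

Lemma count_runs (T : eqType) (w : seq T) s x :
  count_mem x (runs w s) = sumn [seq p.2 | p <- zip w s & p.1 == x].
Proof.
elim: w s => [|y w IHw] [|k s] //=.
rewrite count_cat count_nseq IHw /=.
by case: eqP => /= _; lia.
Qed.

Lemma all_runs (T : eqType) (w : seq T) s (P : pred T) : all P w -> all P (runs w s).
Proof.
elim: w s => [|y w IHw] [|k s] //= /andP[Py Pw].
by rewrite all_cat all_nseq Py orbT IHw.
Qed.

Definition cyc (T : Type) (u v : seq T) := exists k, u = rot k v.

Lemma cyc_refl (T : Type) (u : seq T) : cyc u u.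
Proof. by exists 0; rewrite rot0. Qed.

Lemma cyc_trans (T : Type) (u v w : seq T) : cyc u v -> cyc v w -> cyc u w.
Proof.
move=> [i ->] [j ->].
have [lt_j|le_j] := ltnP (size w) j; last first.
  have [lt_i|le_i] := ltnP (size w) i; last by rewrite rot_add_mod //; eexists.
  by exists j; rewrite [LHS]rot_oversize // size_rot ltnW.
by exists i; rewrite (rot_oversize (ltnW lt_j)).
Qed.

Lemma cyc_catC (T : Type) (u v : seq T) : cyc (u ++ v) (v ++ u).
Proof. by exists (size v); rewrite rot_size_cat. Qed.

Lemma cyc_filter (T : Type) (P : pred T) (u v : seq T) :
  cyc u v -> cyc (filter P u) (filter P v).
Proof.
move=> [k ->]; rewrite /rot filter_cat -{3}(cat_take_drop k v) filter_cat.
exact: cyc_catC.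
Qed.

Lemma cyc_runs (T : Type) k (w : seq T) s :
  size s = size w -> cyc (runs w s) (runs (rot k w) (rot k s)).
Proof.
move=> sz; rewrite /rot runs_cat ?size_drop ?sz //.
rewrite -{1}(cat_take_drop k w) -{1}(cat_take_drop k s) runs_cat.
  exact: cyc_catC.
by rewrite !size_take sz.
Qed.

Lemma zip_rot (T U : Type) k (u : seq T) (v : seq U) :
  size u = size v -> zip (rot k u) (rot k v) = rot k (zip u v).
Proof.
move=> sz; rewrite -{1}(@unzip1_zip _ _ u v) ?sz // -{2}(@unzip2_zip _ _ u v) ?sz //.
by rewrite -!map_rot zip_unzip.
Qed.

(** * Arcs and patterns of cuts *)

(* An element whose membership bit equals [c] falsifies the answer, so [c = false]
   encodes the answer yes. *)
Definition answer (c : bool) (l : seq nat) (b : seq bool) : seq nat :=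
  [seq x <- [seq p.1 + (p.2 == c) | p <- zip l b] | x < 4].

(* Greedy test that consecutive runs on the levels [L] fit into consecutive arcs on
   the levels [w]; runs of dead elements (level at least 4) are skipped. *)
Fixpoint emb (w : seq nat) : seq nat -> bool :=
  fix emb_w L := match L with
  | [::] => true
  | x :: L' =>
    if 3 < x then emb_w L' else
    match w with
    | [::] => false
    | y :: w' => if x == y then emb_w L' else emb w' L
    end
  end.

(** Arcs of [w] that are passed over get size 0, and runs placed in the same arc have their sizes
    added. Hence a test on levels alone settles every choice of sizes. *)
Lemma emb_runs w L s : emb w L -> size s = size L ->
  exists2 s', size s' = size w & [seq x <- runs L s | x < 4] = runs w s'.
Proof.
elim: w L s => [|y w IHw].
  elim=> [|x L IHL] [|k s] //= => [_ _|]; first by exists [::].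
  have [lt_x|//] := ltnP 3 x => eL [/(IHL _ eL)].
  by rewrite filter_cat filter_nseq ltnS leqNgt lt_x.
elim=> [|x L IHL] [|k s] //=.
  move=> _ _; exists (nseq (size w).+1 0); rewrite /= ?size_nseq //.
  by elim: (w) => //= z v <-.
rewrite filter_cat filter_nseq ltnS.
have [lt_x|le_x] := ltnP 3 x.
  by move=> eL [/(IHL _ eL)].
have [->|ne_xy] := eqVneq x y.
  move=> eL [/(IHL _ eL)][[|i s'] // [sz_s'] ->].
  by exists ((k + i) :: s'); rewrite /= ?sz_s' // nseqD catA mul1n.
move=> eL sz; have [s' sz_s' def_s'] := IHw _ (k :: s) eL sz.
exists (0 :: s'); rewrite /= ?sz_s' // -def_s' /=.
by rewrite filter_cat filter_nseq ltnS le_x.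
Qed.

(* A subword of a well-shaped word (see [full_arcs]), found by computer search. *)
Definition arcs : seq nat := [:: 0; 1; 2; 3; 1; 3; 2; 3; 2; 1].

Definition shaped (l : seq nat) : Prop :=
  exists w s, [/\ w \in [:: arcs; rev arcs], size s = 10 & cyc l (runs w s)].

(* The number of maximal blocks of [true] in [b], not counting an initial one that
   continues a previous bit [p]. *)
Fixpoint ups (p : bool) (b : seq bool) : nat :=
  if b is x :: b' then ~~ p && x + ups x b' else 0.

(* Asking the complement of a question only exchanges the two answers. *)
Definition few_intervals (b : seq bool) : bool :=
  (ups false b <= 4) || (ups false (map negb b) <= 4).

(** An arc cut at most once is two consecutive half-arcs, either possibly empty. *)
Definition doubled (T : Type) (w : seq T) : seq T := flatten [seq [:: x; x] | x <- w].

Definition unpaired (chi : seq (bool * bool)) : seq bool :=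
  flatten [seq [:: p.1; p.2] | p <- chi].

Definition answer_levels (c : bool) (w : seq nat) (chi : seq (bool * bool)) : seq nat :=
  [seq p.1 + (p.2 == c) | p <- zip (doubled w) (unpaired chi)].

Definition keeps_shape (w : seq nat) (chi : seq (bool * bool)) : bool :=
  [&& size chi == 10, few_intervals (unpaired chi) &
      all (fun c => has (fun v => has (fun k => emb v (rot k (answer_levels c w chi)))
                                 (iota 0 20))
                        [:: arcs; rev arcs])
          [:: true; false]].

Fixpoint blocks (p : bool) (ks : seq nat) : seq bool :=
  if ks is k :: ks' then nseq k p ++ blocks (~~ p) ks' else [::].

Fixpoint paired (b : seq bool) : seq (bool * bool) :=
  if b is x :: y :: b' then (x, y) :: paired b' else [::].

(* Every arc consists of two halves, so a pattern is a list of twenty bits, given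
   here by the lengths of its maximal blocks.  The patterns were found by computer
   search as a small solution of the covering problem of [half_covered] and
   [unit_covered]. *)
Definition base_cuts : seq (seq (bool * bool)) :=
  [seq paired (blocks false ks) | ks <- [::
     [:: 1; 2; 1; 2; 1; 5; 1; 2; 5];
     [:: 1; 5; 4; 1; 4; 2; 1; 1; 1];
     [:: 1; 3; 1; 1; 3; 3; 3; 3; 2];
     [:: 1; 2; 1; 1; 1; 4; 1; 4; 5];
     [:: 1; 5; 3; 1; 1; 2; 1; 2; 4];
     [:: 1; 4; 1; 1; 5; 3; 3; 1; 1];
     [:: 1; 2; 1; 2; 1; 5; 3; 2; 3];
     [:: 1; 6; 5; 1; 1; 1; 3; 1; 1];
     [:: 1; 1; 4; 3; 3; 3; 2; 1; 2];
     [:: 1; 1; 5; 2; 3; 2; 2; 1; 3];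
     [:: 1; 1; 4; 3; 3; 1; 1; 1; 5];
     [:: 1; 3; 1; 1; 3; 2; 3; 2; 4];
     [:: 1; 5; 1; 2; 3; 1; 1; 2; 4];
     [:: 1; 6; 5; 2; 2; 1; 1; 1; 1];
     [:: 1; 2; 3; 4; 1; 3; 2; 1; 3];
     [:: 1; 4; 5; 1; 3; 2; 2; 1; 1];
     [:: 1; 4; 1; 1; 2; 3; 2; 2; 4];
     [:: 1; 2; 1; 1; 2; 5; 2; 2; 4];
     [:: 1; 2; 3; 4; 1; 2; 1; 2; 4];
     [:: 1; 5; 3; 1; 1; 3; 2; 1; 3];
     [:: 1; 5; 4; 1; 2; 1; 2; 3; 1]
  ]].

(** Complementing a pattern exchanges the answers. For the reversed word the patterns are mirrored,
    which also swaps the halves of each arc. *)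
Definition cuts (w : seq nat) : seq (seq (bool * bool)) :=
  let cs := base_cuts ++ [seq [seq (~~ p.1, ~~ p.2) | p <- c] | c <- base_cuts] in
  if w == arcs then cs else [seq rev [seq (p.2, p.1) | p <- c] | c <- cs].

Lemma cuts_keep_shape w chi :
  w \in [:: arcs; rev arcs] -> chi \in cuts w -> keeps_shape w chi.
Proof.
rewrite !inE => /orP[]/eqP-> ; move: chi; apply/allP; vm_compute; reflexivity.
Qed.

(* The arcs of sizes [x] can be cut according to [c] so that exactly [t] elements lie
   in the question. *)
Definition fit (c : seq (bool * bool)) (x : seq nat) (t : nat) : bool :=
  (sumn [seq (p.1.1 && p.1.2) * p.2 | p <- zip c x] <= t)
  && (t <= sumn [seq (p.1.1 || p.1.2) * p.2 | p <- zip c x]).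

Definition at_level (T : Type) (i : nat) (w : seq nat) (s : seq T) : seq T :=
  [seq p.2 | p <- zip w s & p.1 == i].

Definition fits (w : seq nat) (chi : seq (bool * bool)) (e : nat -> seq nat * nat) :=
  all (fun i => fit (at_level i w chi) (e i).1 (e i).2) (iota 0 4).

(* For three arcs, the patterns that fit the sizes [x, y, z] and the target [t] depend
   only on which partial sums of the sizes are below [t]; the following lists contain
   one representative for each possibility (see [compatible]). *)
Definition half_classes : seq (seq nat * nat) :=
  [:: ([:: 2; 0; 0], 1); ([:: 0; 2; 0], 1); ([:: 0; 0; 2], 1); ([:: 2; 2; 2], 3)].

Definition third_classes : seq (seq nat * nat) :=
  half_classes ++
  [:: ([:: 0; 2; 2], 1); ([:: 0; 2; 2], 3); ([:: 2; 0; 2], 1); ([:: 2; 0; 2], 3);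
      ([:: 2; 2; 0], 1); ([:: 2; 2; 0], 3); ([:: 2; 2; 4], 3); ([:: 2; 2; 4], 5);
      ([:: 2; 4; 2], 3); ([:: 2; 4; 2], 5); ([:: 4; 2; 2], 3); ([:: 4; 2; 2], 5)].

Definition all_classes : seq (seq nat * nat) :=
  [:: ([:: 2; 2; 2], 1), ([:: 2; 2; 2], 5) & third_classes].

Definition unit_classes : seq (seq nat * nat) :=
  [:: ([:: 0; 0; 0], 0); ([:: 1; 0; 0], 1); ([:: 0; 1; 0], 1); ([:: 0; 0; 1], 1)].

(** The entry [([:: 2], 1)] forces the only arc of level 0 to be properly cut, so that any number of
    its elements can be chosen. *)
Definition covered w e1 e2 e3 :=
  has (fun chi => fits w chi (nth ([::], 0) [:: ([:: 2], 1); e1; e2; e3])) (cuts w).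

Lemma half_covered w e1 e2 e3 :
  w \in [:: arcs; rev arcs] -> e1 \in half_classes -> e2 \in half_classes ->
  e3 \in third_classes -> covered w e1 e2 e3.
Proof.
have : all (fun w => all (fun e1 => all (fun e2 => all (covered w e1 e2)
   third_classes) half_classes) half_classes) [:: arcs; rev arcs].
  by vm_compute; reflexivity.
by move=> /allP H /H /allP{}H /H /allP{}H /H /allP{}H /H.
Qed.

Lemma unit_covered w e1 e2 e3 :
  w \in [:: arcs; rev arcs] -> e1 \in unit_classes -> e2 \in unit_classes ->
  e1.2 + e2.2 <= 1 -> e3 \in all_classes -> covered w e1 e2 e3.
Proof.
have : all (fun w => all (fun e1 => all (fun e2 => (e1.2 + e2.2 <= 1) ==>
   all (covered w e1 e2) all_classes) unit_classes) unit_classes) [:: arcs; rev arcs].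
  by vm_compute; reflexivity.
by move=> /allP H /H /allP{}H /H /allP{}H /H /implyP{}H /H /allP{}H /H.
Qed.

(** * Realizing prescribed level sizes *)

Definition same_side (x t x' t' : nat) : bool :=
  ((x' <= t') ==> (x <= t)) && ((t' <= x') ==> (t <= x)).

Definition compatible (x y z t : nat) (e : seq nat * nat) : bool :=
  if e is ([:: x'; y'; z'], t') then
    [&& same_side x t x' t', same_side y t y' t', same_side z t z' t',
        same_side (x + y) t (x' + y') t', same_side (x + z) t (x' + z') t',
        same_side (y + z) t (y' + z') t', 0 < t' & t' < x' + y' + z']
  else false.

(** Both bounds of [fit] compare the target with the sum of a subset of the three arcs. [same_side]
    transfers this for one or two arcs; the strict bounds on the target of [e] exclude a full lower
    sum and an empty upper sum. *)
Lemma compatible_fit x y z t e c :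
  t <= x + y + z -> compatible x y z t e -> size c = 3 ->
  fit c e.1 e.2 -> fit c [:: x; y; z] t.
Proof.
case: e => [[|x' [|y' [|z' []]]] t'] //= le_t.
case: c => [|[c1 d1] [|[c2 d2] [|[c3 d3] []]]] //=.
rewrite /fit /same_side /=.
by case: c1 d1 c2 d2 c3 d3 => [] [] [] [] [] [] /=; lia.
Qed.

Definition halved a t := (a <= t.*2.+1) && (t.*2 <= a.+1).

(** If one arc exceeds [t], or the other two together fall short of it, that arc dominates and is
    the only nonempty one of the representative. Otherwise [([:: 2; 2; 2], 3)] applies. *)
Lemma half_compatible x y z t :
  halved (x + y + z) t -> 0 < x + y + z -> has (compatible x y z t) half_classes.
Proof.
rewrite /halved => ht pos.
have [hx|hx] := boolP ((x <= t) && (t <= y + z)); last first.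
  by apply/hasP; exists ([:: 2; 0; 0], 1); rewrite ?inE //= /same_side /=; lia.
have [hy|hy] := boolP ((y <= t) && (t <= x + z)); last first.
  by apply/hasP; exists ([:: 0; 2; 0], 1); rewrite ?inE //= /same_side /=; lia.
have [hz|hz] := boolP ((z <= t) && (t <= x + y)); last first.
  by apply/hasP; exists ([:: 0; 0; 2], 1); rewrite ?inE //= /same_side /=; lia.
by apply/hasP; exists ([:: 2; 2; 2], 3); rewrite ?inE //= /same_side /=; lia.
Qed.

Lemma all_compatible x y z t : has (compatible x y z t) all_classes.
Proof.
have leP u v : (u <= v) + (v <= u) * ~~ (u <= v) by case: leqP => [|/ltnW]; [left|right].
rewrite /= /same_side /=.
have hxy : ~~ (x <= t) || ~~ (y <= t) ==> ~~ (x + y <= t) by lia.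
have hxz : ~~ (x <= t) || ~~ (z <= t) ==> ~~ (x + z <= t) by lia.
have hyz : ~~ (y <= t) || ~~ (z <= t) ==> ~~ (y + z <= t) by lia.
move: hxy hxz hyz.
by case: (leP x t) (leP y t) (leP z t) (leP (x + y) t) (leP (x + z) t) (leP (y + z) t)
  => [->|[-> /negPf->]] [->|[-> /negPf->]] [->|[-> /negPf->]]
     [->|[-> /negPf->]] [->|[-> /negPf->]] [->|[-> /negPf->]] //=;
  rewrite ?(andbT, andbF, orbT).
Qed.

(** The two extra classes of [all_classes] put [t] below every arc or above every sum of two arcs.
    Between the thirds this forces equalities, and [([:: 2; 2; 2], 3)] is compatible as well. *)
Lemma third_compatible x y z t :
  x + y + z <= t * 3 -> t * 3 <= (x + y + z) * 2 ->
  has (compatible x y z t) third_classes.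
Proof.
move=> ge_t le_t.
have [c1|n1] := boolP (compatible x y z t ([:: 2; 2; 2], 1)).
  apply/hasP; exists ([:: 2; 2; 2], 3); rewrite ?inE //=.
  by move: c1; rewrite /= /same_side /=; lia.
have [c5|n5] := boolP (compatible x y z t ([:: 2; 2; 2], 5)).
  apply/hasP; exists ([:: 2; 2; 2], 3); rewrite ?inE //=.
  by move: c5; rewrite /= /same_side /=; lia.
have : [|| compatible x y z t ([:: 2; 2; 2], 1), compatible x y z t ([:: 2; 2; 2], 5)
          | has (compatible x y z t) third_classes] := all_compatible x y z t.
by rewrite (negPf n1) (negPf n5).
Qed.

Lemma cut_arcs w s chi t :
  size s = size w -> size chi = size w ->
  (forall i, fit (at_level i w chi) (at_level i w s) (t i)) ->
  exists z, [/\ size z = size (doubled w), runs (doubled w) z = runs w s &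
    forall i, count_mem (i, true) (zip (runs (doubled w) z) (runs (unpaired chi) z)) = t i].
Proof.
elim: w s chi t => [|l w IHw] [|x s] [|[c d] chi] t //=.
  by move=> _ _ ft; exists [::]; split=> //= i; move: (ft i); rewrite /fit /=; case: (t i).
move=> [sz_s] [sz_c] ft.
pose lo := sumn [seq (p.1.1 && p.1.2) * p.2 | p <- zip (at_level l w chi) (at_level l w s)].
pose hi := sumn [seq (p.1.1 || p.1.2) * p.2 | p <- zip (at_level l w chi) (at_level l w s)].
have ftl : (c && d) * x + lo <= t l <= (c || d) * x + hi.
  by move: (ft l); rewrite /fit /at_level /= eqxx.
have le_lohi : lo <= hi.
  rewrite /lo /hi; elim: zip => //= -[[[] []] y] q IHq /=; lia.
(* The least admissible share of this arc: what is forced, or what later arcs of level [l] cannot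
   supply. *)
pose e := maxn ((c && d) * x) (t l - hi).
have [le_e ge_e] : (c && d) * x <= e /\ e <= (c || d) * x.
  by rewrite /e; case: (c) (d) ftl => [] [] /=; lia.
have [lo_e e_hi] : lo <= t l - e /\ t l - e <= hi by rewrite /e; lia.
have le_et : e <= t l by rewrite /e; lia.
(* The size of the first half, chosen so that exactly [e] elements lie in the question. *)
pose f := if c then (if d then 0 else e) else x - e.
have def_e : c * f + d * (x - f) = e /\ f <= x.
  by rewrite /f; case: (c) (d) le_e ge_e => [] [] /=; lia.
have [|z [sz_z runs_z count_z]] :=
    IHw s chi (fun i => if i == l then t l - e else t i) sz_s sz_c.
  move=> i; have [->|ne_il] := eqVneq i l; first by rewrite /fit lo_e e_hi.
  by move: (ft i); rewrite /at_level /= eq_sym (negPf ne_il).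
exists [:: f, x - f & z]; split=> /=.
- by rewrite sz_z.
- by rewrite runs_z catA -nseqD subnKC //; case: def_e.
move=> i; rewrite !zip_cat ?size_nseq // !zip_nseq !count_cat !count_nseq count_z /=.
rewrite !xpair_eqE; move: le_et; have [->|ne_il _] := eqVneq l i.
  by case: def_e => + _; case: (c) (d) => [] [] /=; lia.
by [].
Qed.

(** * The game on lists of levels *)

Lemma ups_cat p u v : ups p (u ++ v) = ups p u + ups (last p u) v.
Proof. by elim: u p => //= x u IHu p; rewrite IHu addnA. Qed.

Lemma ups_negb p b : ups p b + p = ups (~~ p) (map negb b) + last p b.
Proof. by elim: b p => //= x b IHb p; have := IHb x; case: p; case: x => /=; lia. Qed.

Lemma ups_start p b : ups p b <= ups false b.
Proof. by case: b p => //= x b [] /=; lia. Qed.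

(** Lengthening a run creates no block, and emptying one can only delete or merge blocks. *)
Lemma ups_runs p w s : ups p (runs w s) <= ups p w.
Proof.
elim: w s p => [|x w IHw] [|k s] p //=.
have le_x : ups p (runs w s) <= ~~ p && x + ups x (runs w s).
  by case: (runs w s) p x => [|y r] [] [] //=; lia.
case: k => [|k] /=; first by apply: leq_trans le_x _; rewrite leq_add2l.
rewrite leq_add2l ups_cat.
have -> : ups x (nseq k x) = 0 by elim: k => //= k ->; case: x {le_x}.
have -> : last x (nseq k x) = x by elim: k.
exact: IHw.
Qed.

Lemma few_intervals_negb b : few_intervals (map negb b) = few_intervals b.
Proof.
by rewrite /few_intervals orbC -map_comp (eq_map negbK) map_id.
Qed.

Lemma few_intervals_runs w s : few_intervals w -> few_intervals (runs w s).
Proof.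
by case/orP=> le4; apply/orP; [left|right]; apply: leq_trans le4;
  rewrite ?map_runs ups_runs.
Qed.

(** A rotation can cut a block of [true] only if the moved prefix ends with [true]. Then the blocks
    of [false] in the result are at most as many as the original blocks of [true], and the
    complement qualifies. *)
Lemma few_intervals_rot k b : few_intervals b -> few_intervals (rot k b).
Proof.
suff main c : ups false c <= 4 -> few_intervals (rot k c).
  by case/orP=> /main //; rewrite -map_rot few_intervals_negb.
rewrite /rot -{1}(cat_take_drop k c); move: (take k c) (drop k c) => u v.
rewrite /few_intervals ups_cat.
have [last_u|last_u] := boolP (last false u); last first.
  move=> le4; rewrite ups_cat; apply/orP; left; apply: leq_trans le4.
  by rewrite addnC leq_add2r ups_start.
move=> le4; apply/orP; right.
have := ups_negb true (v ++ u); rewrite last_cat.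
have -> : last (last true v) u = true by case: (u) last_u.
rewrite ups_cat /=; have := ups_start (last true v) u; lia.
Qed.

Lemma answer_rot c k l b : size l = size b ->
  cyc (answer c (rot k l) (rot k b)) (answer c l b).
Proof.
move=> sz; rewrite /answer zip_rot // map_rot.
by apply: cyc_filter; exists k.
Qed.

Lemma size_doubled (T : Type) (w : seq T) : size (doubled w) = (size w).*2.
Proof. by elim: w => //= x w ->. Qed.

Lemma size_unpaired chi : size (unpaired chi) = (size chi).*2.
Proof. by elim: chi => //= x w ->. Qed.

(** [cut_arcs] supplies the half-arc sizes, and [emb_runs] lifts the finite check of [keeps_shape]
    to these sizes. *)
Lemma question_of_cut w s chi t k :
  w \in [:: arcs; rev arcs] -> size s = 10 -> chi \in cuts w ->
  (forall i, fit (at_level i w chi) (at_level i w s) (t i)) ->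
  exists b, [/\ size b = size (rot k (runs w s)), few_intervals b,
    forall c, shaped (answer c (rot k (runs w s)) b) &
    forall i, count_mem (i, true) (zip (rot k (runs w s)) b) = t i].
Proof.
move=> w_in sz_s chi_in fit_t.
have sz_w : size w = 10 by move: w_in; rewrite !inE => /orP[]/eqP->.
have /and3P[/eqP sz_chi few keep] := cuts_keep_shape w_in chi_in.
have [||z [sz_z runs_z count_z]] := @cut_arcs w s chi t _ _ fit_t; rewrite ?sz_w //.
rewrite size_doubled sz_w in sz_z.
have sz_b : size (runs (unpaired chi) z) = size (runs w s).
  by rewrite -runs_z !size_runs ?size_doubled ?size_unpaired ?sz_w ?sz_chi.
exists (rot k (runs (unpaired chi) z)); split.
- by rewrite !size_rot.
- exact/few_intervals_rot/few_intervals_runs.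
- move=> c; have /hasP[v v_in /hasP[j _ emb_v]] : has (fun v => has (fun k =>
      emb v (rot k (answer_levels c w chi))) (iota 0 20)) [:: arcs; rev arcs].
    by apply: (allP keep); case: c.
  have sz_al : size (answer_levels c w chi) = size z.
    by rewrite size_map size1_zip size_doubled ?size_unpaired sz_w ?sz_chi ?sz_z.
  have [|s' sz_s' def_s'] := emb_runs (s := rot j z) emb_v.
    by rewrite !size_rot sz_al.
  exists v, s'; split=> //.
    by rewrite sz_s'; move: v_in; rewrite !inE => /orP[]/eqP->.
  apply: cyc_trans (answer_rot _ _ _) _ => //.
  rewrite -def_s' /answer -runs_z zip_runs map_runs.
  exact/cyc_filter/cyc_runs.
move=> i; rewrite zip_rot // (permP (permEl (perm_rot _ _))) -runs_z.
exact: count_z.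
Qed.

Lemma count_answer c l b i : i < 4 ->
  count_mem i (answer c l b) =
  count_mem (i, ~~ c) (zip l b) + (0 < i) * count_mem (i.-1, c) (zip l b).
Proof.
move=> lt_i; rewrite count_filter count_map.
elim: (zip l b) => [|[x y] z IHz] /=; first by rewrite muln0.
rewrite IHz mulnDr addnACA; congr (_ + _); rewrite !xpair_eqE.
by case: y c {IHz} => [] [] /=; lia.
Qed.

Lemma count_zip (l : seq nat) (b : seq bool) i : size l = size b ->
  count_mem i l = count_mem (i, true) (zip l b) + count_mem (i, false) (zip l b).
Proof.
elim: l b => [|x l IHl] [|y b] //= [/IHl->].
by rewrite !xpair_eqE; case: y => /=; lia.
Qed.

Definition has_type (a0 a1 a2 a3 : nat) (l : seq nat) : Prop :=
  [/\ count_mem 0 l = a0, count_mem 1 l = a1, count_mem 2 l = a2 & count_mem 3 l = a3].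

Definition splits (t0 t1 t2 t3 : nat) (l : seq nat) (b : seq bool) : Prop :=
  forall i, count_mem (i, true) (zip l b) = nth 0 [:: t0; t1; t2; t3] i.

Lemma split_counts a0 a1 a2 a3 t0 t1 t2 t3 l b :
  size l = size b -> has_type a0 a1 a2 a3 l -> splits t0 t1 t2 t3 l b ->
  has_type t0 (t1 + (a0 - t0)) (t2 + (a1 - t1)) (t3 + (a2 - t2)) (answer false l b) /\
  has_type (a0 - t0) (a1 - t1 + t0) (a2 - t2 + t1) (a3 - t3 + t2) (answer true l b).
Proof.
move=> sz [n0 n1 n2 n3] sp.
have := (count_zip 0 sz, count_zip 1 sz, count_zip 2 sz, count_zip 3 sz).
rewrite n0 n1 n2 n3 !sp /= => -[[[e0 e1] e2] e3].
by split; split; rewrite count_answer //= !sp /=; lia.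
Qed.

Lemma size_at_level (T : Type) i w (s : seq T) : size s = size w ->
  size (at_level i w s) = count_mem i w.
Proof.
rewrite /at_level size_map size_filter.
by elim: w s => [|x w IHw] [|y s] //= [/IHw->].
Qed.

Definition question l t0 t1 t2 t3 : Prop :=
  exists b, [/\ size b = size l, few_intervals b,
    forall c, shaped (answer c l b) & splits t0 t1 t2 t3 l b].

Definition level_class (x : seq nat) (t : nat) (e : seq nat * nat) : Prop :=
  forall c, size c = size x -> fit c e.1 e.2 -> fit c x t.

Lemma covered_question w s k t0 t1 t2 t3 e1 e2 e3 :
  w \in [:: arcs; rev arcs] -> size s = 10 ->
  t0 <= sumn (at_level 0 w s) ->
  level_class (at_level 1 w s) t1 e1 -> level_class (at_level 2 w s) t2 e2 ->
  level_class (at_level 3 w s) t3 e3 -> covered w e1 e2 e3 ->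
  question (rot k (runs w s)) t0 t1 t2 t3.
Proof.
move=> w_in sz_s le_t0 cl1 cl2 cl3 /hasP[chi chi_in fits_chi].
have /and3P[/eqP sz_chi _ _] := cuts_keep_shape w_in chi_in.
apply: (question_of_cut k w_in sz_s chi_in) => i.
move: fits_chi; rewrite /fits /= andbT => /and4P[f0 f1 f2 f3].
have sz_w : size w = 10 by move: w_in; rewrite !inE => /orP[]/eqP->.
have szl i' : size (at_level i' w chi) = size (at_level i' w s).
  by rewrite !size_at_level ?sz_w.
have count_w i' : count_mem i' w = nth 0 [:: 1; 3; 3; 3] i'.
  move: w_in; rewrite !inE => /orP[]/eqP-> /=; by case: i' => [|[|[|[|[|i']]]]].
case: i => [|[|[|[|i]]]] /=; [|exact: cl1|exact: cl2|exact: cl3|].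
  move: (szl 0) f0 le_t0; rewrite size_at_level ?sz_w // count_w.
  case: (at_level 0 w s) => [|x []] //= _.
  move: (@size_at_level _ 0 w chi); rewrite sz_w count_w => /(_ sz_chi).
  case: (at_level 0 w chi) => [|[c d] []] //= _.
  by rewrite /fit /=; case: c d => [] [] /=; lia.
have -> : at_level i.+4 w chi = [::].
  by apply/size0nil; rewrite size_at_level ?sz_w // count_w /= nth_nil.
by rewrite nth_nil /fit; case: (at_level _ w s).
Qed.

Lemma level_class_in cs x y z t :
  t <= x + y + z -> has (compatible x y z t) cs ->
  exists2 e, e \in cs & level_class [:: x; y; z] t e.
Proof.
move=> le_t /hasP[e e_in comp_e]; exists e => // c sz_c.
exact: compatible_fit comp_e sz_c.
Qed.

Lemma halved_class x y z t : halved (x + y + z) t ->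
  exists2 e, e \in half_classes & level_class [:: x; y; z] t e.
Proof.
move=> ht; have [pos|] := ltnP 0 (x + y + z).
  by apply: level_class_in (half_compatible ht pos); move: ht; rewrite /halved; lia.
rewrite leqn0 !addn_eq0 => /andP[/andP[/eqP x0 /eqP y0] /eqP z0].
exists ([:: 2; 0; 0], 1); rewrite ?inE // => -[|p1 [|p2 [|p3 []]]] // _ _.
by move: ht; rewrite /halved /fit /= x0 y0 z0; lia.
Qed.

Lemma unit_class x y z : x + y + z <= 1 ->
  exists e, [/\ e \in unit_classes, e.2 = x + y + z &
                level_class [:: x; y; z] (x + y + z) e].
Proof.
move=> le1; exists ([:: x; y; z], x + y + z); split=> //.
by move: x y z le1; do 3 (case=> [|[|?]] //).
Qed.

Lemma size3_explicit (T : Type) (s : seq T) : size s = 3 -> exists x y z, s = [:: x; y; z].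
Proof. by case: s => [|x [|y [|z []]]] // _; exists x, y, z. Qed.

Lemma shaped_levels l a0 a1 a2 a3 : shaped l -> has_type a0 a1 a2 a3 l ->
  exists w s k, [/\ w \in [:: arcs; rev arcs], size s = 10, l = rot k (runs w s),
    sumn (at_level 0 w s) = a0 &
    [/\ exists x y z, at_level 1 w s = [:: x; y; z] /\ x + y + z = a1,
        exists x y z, at_level 2 w s = [:: x; y; z] /\ x + y + z = a2 &
        exists x y z, at_level 3 w s = [:: x; y; z] /\ x + y + z = a3]].
Proof.
move=> [w [s [w_in sz_s [k ->]]]] [c0 c1 c2 c3].
have cE i : count_mem i (rot k (runs w s)) = sumn (at_level i w s).
  by rewrite (permP (permEl (perm_rot _ _))) count_runs.
rewrite !cE in c0 c1 c2 c3.
have sz i : 0 < i < 4 -> size (at_level i w s) = 3.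
  move=> lt_i; move: w_in; rewrite !inE => /orP[]/eqP->;
  by rewrite size_at_level ?sz_s //; move: i lt_i => [|[|[|[|?]]]].
exists w, s, k; split=> //; split.
- have [x [y [z e]]] := size3_explicit (sz 1 isT); exists x, y, z.
  by move: c1; rewrite e /= addn0 addnA.
- have [x [y [z e]]] := size3_explicit (sz 2 isT); exists x, y, z.
  by move: c2; rewrite e /= addn0 addnA.
- have [x [y [z e]]] := size3_explicit (sz 3 isT); exists x, y, z.
  by move: c3; rewrite e /= addn0 addnA.
Qed.

Lemma balanced_question l a0 a1 a2 a3 t0 t1 t2 t3 :
  shaped l -> has_type a0 a1 a2 a3 l -> t0 <= a0 -> halved a1 t1 -> halved a2 t2 ->
  a3 <= t3 * 3 -> t3 * 3 <= a3 * 2 -> question l t0 t1 t2 t3.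
Proof.
move=> shl nl; have [w [s [k [w_in sz_s -> <- [L1 L2 L3]]]]] := shaped_levels shl nl.
have [x1 [y1 [z1 [e1 <-]]]] := L1; have [x2 [y2 [z2 [e2 <-]]]] := L2.
have [x3 [y3 [z3 [e3 <-]]]] := L3.
move=> le_t0 /halved_class[c1 c1_in cl1] /halved_class[c2 c2_in cl2] ge_t3 le_t3.
have [|c3 c3_in cl3] := level_class_in _ (third_compatible ge_t3 le_t3); first lia.
apply: covered_question (half_covered w_in c1_in c2_in c3_in); rewrite ?e1 ?e2 ?e3 //.
Qed.

(** For the endgame: a single element below level 3 cannot be halved, so it goes into the question
    and level 3 does all the balancing. *)
Lemma isolating_question l a0 a1 a2 a3 t3 :
  shaped l -> has_type a0 a1 a2 a3 l -> a0 + a1 + a2 <= 1 -> t3 <= a3 ->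
  question l a0 a1 a2 t3.
Proof.
move=> shl nl; have [w [s [k [w_in sz_s -> <- [L1 L2 L3]]]]] := shaped_levels shl nl.
have [x1 [y1 [z1 [e1 <-]]]] := L1; have [x2 [y2 [z2 [e2 <-]]]] := L2.
have [x3 [y3 [z3 [e3 <-]]]] := L3.
move=> le1 le_t3.
have [|c1 [c1_in s1 cl1]] := @unit_class x1 y1 z1; first lia.
have [|c2 [c2_in s2 cl2]] := @unit_class x2 y2 z2; first lia.
have [c3 c3_in cl3] := level_class_in le_t3 (all_compatible _ _ _ _).
have le12 : c1.2 + c2.2 <= 1 by lia.
apply: covered_question (unit_covered w_in c1_in c2_in le12 c3_in); rewrite ?e1 ?e2 ?e3 //.
Qed.

(** * Winning positions on lists of levels *)

Fixpoint wins (r : nat) (l : seq nat) : Prop :=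
  shaped l /\
  match r with
  | 0 => size l <= 1
  | r'.+1 => exists b, [/\ size b = size l, few_intervals b,
                           wins r' (answer false l b) & wins r' (answer true l b)]
  end.

(** Quantifying over all shaped lists reduces the game to the level sizes. *)
Definition winning_type (r a0 a1 a2 a3 : nat) : Prop :=
  forall l, shaped l -> has_type a0 a1 a2 a3 l -> wins r l.

Lemma winning_type0 a0 a1 a2 a3 :
  a0 + a1 + a2 + a3 <= 1 -> winning_type 0 a0 a1 a2 a3.
Proof.
move=> le1 l shl [n0 n1 n2 n3]; split=> //.
have [w [s [w_in sz_s [k def_l]]]] := shl.
have : all (fun x => x < 4) l.
  have all_w : all (fun x => x < 4) w by move: w_in; rewrite !inE => /orP[]/eqP->.
  by rewrite def_l (perm_all _ (permEl (perm_rot _ _))) all_runs.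
suff sz : all (fun x => x < 4) l -> size l =
    count_mem 0 l + count_mem 1 l + count_mem 2 l + count_mem 3 l.
  by move/sz->; rewrite n0 n1 n2 n3.
by elim: {shl n0 n1 n2 n3 def_l} l => //= x l IHl /andP[lt_x /IHl->]; lia.
Qed.

Lemma winning_type_question r a0 a1 a2 a3 t0 t1 t2 t3 :
  (forall l, shaped l -> has_type a0 a1 a2 a3 l -> question l t0 t1 t2 t3) ->
  winning_type r t0 (t1 + (a0 - t0)) (t2 + (a1 - t1)) (t3 + (a2 - t2)) ->
  winning_type r (a0 - t0) (a1 - t1 + t0) (a2 - t2 + t1) (a3 - t3 + t2) ->
  winning_type r.+1 a0 a1 a2 a3.
Proof.
move=> qu win_yes win_no l shl nl; split=> //.
have [b [sz_b few sh_b sp]] := qu l shl nl.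
have [] := split_counts (esym sz_b) nl sp.
by exists b; split=> //; [apply: win_yes | apply: win_no].
Qed.

(** * From lists of levels to strategies *)

Definition covers (I : seq (nat * nat)) (x : nat) : bool :=
  has (fun ab => ab.1 <= x <= ab.2) I.

(** Intervals may run over the gaps in [xs], so each block of [true] costs one interval. The clause
    on [head false b] lets the induction extend the first interval to the left. *)
Lemma intervals_of_mask (xs : seq nat) (b : seq bool) :
  sorted ltn xs -> size xs = size b ->
  exists I, [/\ size I = ups false b, all (fun ab => head 0 xs <= ab.1) I,
    head false b -> exists e r, I = (head 0 xs, e) :: r /\ head 0 xs <= e
    & map (covers I) xs = b].
Proof.
elim: xs b => [|x xs IHxs] [|y b] //=; first by exists [::].
move=> px [sz_b]; have [I [szI loI headI covI]] := IHxs b (path_sorted px) sz_b.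
have lt_xs : {in xs, forall z, x < z}.
  by apply/allP; apply: order_path_min px => ? ? ?; apply: ltn_trans.
have lt_I : all (fun ab => x < ab.1) I.
  case: (xs) lt_xs loI covI => [|z zs] lt_xs loI covI.
    by move: covI szI => <- /=; case: (I).
  by apply: sub_all loI => ab; apply: leq_trans; apply: lt_xs; rewrite inE eqxx.
have not_cov : covers I x = false.
  apply/negbTE/hasPn => ab /(allP lt_I); lia.
case: y => /=; last first.
  exists I; split=> //=; last by rewrite not_cov covI.
  by apply: sub_all lt_I => ab /ltnW.
case hb: (head false b); last first.
  exists ((x, x) :: I); split=> //=.
  - by rewrite szI; case: (b) hb => //= -[].
  - by rewrite leqnn; apply: sub_all lt_I => ab /ltnW.
  - by exists x, I.
  rewrite {1}/covers /= leqnn /= -covI; congr (_ :: _).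
  apply/eq_in_map => z /lt_xs lt_xz; rewrite /covers /=; lia.
have [e [r [defI le_e]]] := headI hb.
exists ((x, e) :: r); split=> //=.
- by move: szI; rewrite defI /=; case: (b) hb => //= -[].
- rewrite leqnn; move: lt_I; rewrite defI /= => /andP[_].
  by apply: sub_all => ab /ltnW.
- exists e, r; split=> //; apply: leq_trans le_e.
  by move: lt_I; rewrite defI /= => /andP[/ltnW].
rewrite -covI; congr (_ :: _).
  rewrite /covers /= leqnn /=.
  by move: lt_I; rewrite defI /= => /andP[/ltnW le_x _]; rewrite (leq_trans le_x).
apply/eq_in_map => z z_in; rewrite /covers defI /=; congr (_ || _).
rewrite (ltnW (lt_xs _ z_in)) /=; suff -> : head 0 xs <= z by [].
case: (xs) px z_in => //= u us /andP[_ pu]; rewrite inE => /predU1P[->//|].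
have : all (ltn u) us by apply: order_path_min pu => ? ? ?; apply: ltn_trans.
by move=> /allP H /H /ltnW.
Qed.

Lemma four_interval_covers n I : size I <= 4 ->
  four_interval_question [set x : 'I_n | covers I x].
Proof.
(* The default [(1, 0)] pads with empty intervals. *)
move=> szI; exists (fun i => [set x : 'I_n | (nth (1, 0) I i).1 <= x <= (nth (1, 0) I i).2]).
split=> [i|]; first by exists (nth (1, 0) I i).1, (nth (1, 0) I i).2.
apply/setP=> x; rewrite inE; apply/idP/bigcupP => [|[i _]].
  case/(has_nthP (1, 0)) => i lt_i cov_i.
  by exists (Ordinal (leq_trans lt_i szI)); rewrite // inE.
rewrite inE => cov_i; apply/(has_nthP (1, 0)); exists i => //.
by rewrite ltnNge; apply/negP => le_i; move: cov_i; rewrite nth_default //=; lia.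
Qed.

Definition live n (s : state n) : seq 'I_n := [seq x <- enum 'I_n | s x < 4].
Definition levels n (s : state n) : seq nat := map s (live s).

(** Truncation at 4 only touches dead elements, and these stay dead. *)
Lemma levels_add n (s s' : state n) (g : 'I_n -> nat) :
  (forall x, s' x = minn (s x + g x) 4) ->
  levels s' = [seq y <- [seq s x + g x | x <- live s] | y < 4].
Proof.
move=> s'E; rewrite filter_map /live -filter_predI /levels /live.
rewrite (@eq_filter _ (fun x => s' x < 4)
  (predI (preim (fun x => s x + g x) (ltn^~ 4)) (fun x => s x < 4))).
  apply/eq_in_map => x; rewrite mem_filter s'E /= => /andP[/andP[lt4 _] _]; lia.
by move=> x; rewrite /= s'E; lia.
Qed.

Lemma levels_upd n (s : state n) Q :
  levels (upd_yes s Q) = answer false (levels s) [seq x \in Q | x <- live s] /\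
  levels (upd_no s Q) = answer true (levels s) [seq x \in Q | x <- live s].
Proof.
rewrite /answer zip_map -!map_comp; split.
  rewrite (@levels_add n s _ (fun x => x \notin Q)) => [|x]; last by rewrite ffunE.
  by congr filter; apply: eq_map => x /=; rewrite eqbF_neg.
rewrite (@levels_add n s _ (fun x => x \in Q)) => [|x]; last by rewrite ffunE.
by congr filter; apply: eq_map => x /=; rewrite eqb_id.
Qed.

Lemma card_support n (s : state n) : #|Defs.support s| = size (levels s).
Proof.
rewrite size_map /live cardE enumT; congr size.
by apply: eq_filter => x; rewrite /= inE.
Qed.

Lemma question_of_mask n (s : state n) b :
  size b = size (levels s) -> ups false b <= 4 ->
  exists2 Q, four_interval_question Q & [seq x \in Q | x <- live s] = b.
Proof.
rewrite size_map => sz le4.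
have [||I [szI _ _ covI]] := @intervals_of_mask (map val (live s)) b.
- by rewrite sorted_map; apply: sorted_filter;
    [move=> ? ? ?; apply: ltn_trans | rewrite -sorted_map val_enum_ord iota_ltn_sorted].
- by rewrite size_map.
exists [set x : 'I_n | covers I x]; first by apply: four_interval_covers; rewrite szI.
by rewrite -covI -map_comp; apply: eq_map => x; rewrite inE.
Qed.


Lemma answer_negb c l b : answer c l (map negb b) = answer (~~ c) l b.
Proof.
rewrite /answer; congr filter; elim: l b => [|x l IHl] [|y b] //=.
by rewrite IHl; case: y c {IHl} => [] [].
Qed.

Lemma strategy_of_wins n r (s : state n) :
  (forall s' : state n, shaped (levels s') -> well_shaped s') ->
  wins r (levels s) ->
  exists t : strategy n, [/\ complete_of_depth r t, leaves_final s t,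
    all_questions (@four_interval_question n) t & all_states (@well_shaped n) s t].
Proof.
move=> shP; elim: r s => [|r IHr] s [shs].
  move=> le1; exists Leaf; split=> //=; first by rewrite /final card_support.
  by split=> //; apply: shP.
move=> [b [sz_b few win_yes win_no]].
have [Q [b' [four_Q]]] : exists Q b', [/\ four_interval_question Q,
    [seq x \in Q | x <- live s] = b', wins r (answer false (levels s) b')
    & wins r (answer true (levels s) b')].
  case/orP: few => le4.
    by have [Q fourQ defb] := question_of_mask sz_b le4; exists Q, b.
  have [|Q fourQ defb] := question_of_mask (s := s) _ le4; first by rewrite size_map.
  by exists Q, (map negb b); rewrite !answer_negb.
move=> defb' wy wn; have [] := levels_upd s Q; rewrite defb' => ey en.
rewrite -ey in wy; rewrite -en in wn.
have [ty [cy ly qy sy]] := IHr _ wy; have [tn [cn ln qn sn]] := IHr _ wn.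
by exists (Node Q ty tn); split=> //=; split=> //; apply: shP.
Qed.

(** * Shaped lists give well-shaped states *)

Definition full_arcs : seq nat := [:: 0; 1; 2; 3; 2; 1; 2; 3; 2; 3; 2; 1].

(** [full_arcs] has the required 1, 3, 5 and 3 arcs on levels 0 to 3. It is [arcs] with two empty
    arcs of level 2 inserted around the inner arc of level 1. *)
Lemma shaped_full l : shaped l ->
  exists w s, [/\ w \in [:: full_arcs; rev full_arcs], size s = 12 & cyc l (runs w s)].
Proof.
move=> [w [s [w_in sz_s cyc_l]]].
have [v [v_in emb_v]] : exists v, v \in [:: full_arcs; rev full_arcs] /\ emb v w.
  move: w_in; rewrite !inE => /orP[]/eqP->; first by exists full_arcs.
  by exists (rev full_arcs).
have sz_w : size s = size w by rewrite sz_s; move: w_in; rewrite !inE => /orP[]/eqP->.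
have [s' sz_s' defs'] := emb_runs emb_v sz_w.
exists v, s'; split=> //; last first.
  rewrite -defs' (all_filterP _) //; apply: all_runs.
  by move: w_in; rewrite !inE => /orP[]/eqP->.
by rewrite sz_s'; move: v_in; rewrite !inE => /orP[]/eqP->.
Qed.

Lemma sorted_runs (w : seq nat) s : sorted ltn w -> sorted leq (runs w s).
Proof.
rewrite !sorted_pairwise; [|exact: leq_trans|exact: ltn_trans].
elim: w s => [|x w IHw] [|k s] //= /andP[lt_x /(IHw s) pw].
rewrite pairwise_cat pw andbT; apply/andP; split.
  apply/allrelP => y z; rewrite mem_nseq => /andP[_ /eqP->] z_in.
  have /allP/(_ z z_in)/ltnW// : all (ltn x) (runs w s) by apply: all_runs.
by elim: k => //= k ->; rewrite all_nseq leqnn orbT.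
Qed.

(** An increasing list rotated to start at [r] increases in [cyc_pos r]: this is [a - r] on [r :: v]
    and [a + n - r] on [u]. *)
Lemma rot_index_cyc_pos n (u v : seq 'I_n) (r : 'I_n) (x y : 'I_n) :
  pairwise (fun a b : 'I_n => a < b) (u ++ r :: v) ->
  x \in r :: v ++ u -> y \in r :: v ++ u ->
  cyc_pos r x <= cyc_pos r y ->
  index x (r :: v ++ u) <= index y (r :: v ++ u).
Proof.
move=> pw x_in y_in; apply: contraTT; rewrite -!ltnNge => lt_xy.
have pw' : sorted (fun a b => cyc_pos r a < cyc_pos r b) ((r :: v) ++ u).
  rewrite sorted_pairwise; last by move=> ? ? ?; apply: ltn_trans.
  move: pw; rewrite !pairwise_cat => /and3P[/allrelP uv pu pv].
  have le_r : {in r :: v, forall a : 'I_n, r <= a}.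
    move=> a; move: pv; rewrite /= inE => /andP[/allP lt_r _] /predU1P[->//|/lt_r]; lia.
  have rv : {in r :: v, forall a, cyc_pos r a = a - r}.
    move=> a a_in; have le_a := le_r a a_in.
    rewrite /cyc_pos (_ : a + n - r = n + (a - r)); last lia.
    by rewrite modnDl modn_small //; have := ltn_ord a; lia.
  have ru : {in u, forall a, cyc_pos r a = a + n - r}.
    move=> a a_in; have lt_a : a < r by apply: uv => //; rewrite inE eqxx.
    by rewrite /cyc_pos modn_small //; have := ltn_ord r; lia.
  apply/and3P; split.
  - by apply/allrelP => a c a_in c_in; rewrite rv // ru //;
      have := ltn_ord a; have := ltn_ord r; lia.
  - apply: (sub_in_pairwise (P := mem (r :: v))) pv; last exact/allP.
    move=> a c a_in c_in lt_ac; rewrite !rv //.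
    by have := le_r a a_in; lia.
  - apply: (sub_in_pairwise (P := mem u)) pu; last exact/allP.
    move=> a c a_in c_in lt_ac; rewrite !ru //.
    by have := ltn_ord r; lia.
have tr : transitive (fun a b : 'I_n => cyc_pos r a < cyc_pos r b).
  by move=> ? ? ?; apply: ltn_trans.
move: (sorted_ltn_nth tr r pw') => /(_ (index y (r :: v ++ u)) (index x (r :: v ++ u))).
by rewrite !inE !index_mem !nth_index //; apply.
Qed.

Lemma shaped_well_shaped n (s : state n) : 0 < n -> shaped (levels s) -> well_shaped s.
Proof.
move=> n_gt0 /shaped_full[w [z [w_in sz_z [k def_l]]]].
have sz_w : size w = 12 by move: w_in; rewrite !inE => /orP[]/eqP->.
pose live' := rotr k (live s).
have def_l' : map s live' = runs w z by rewrite map_rotr -/(levels s) def_l rotK.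
(* The arc numbers along the rotated list of live elements. *)
pose idx := runs (iota 0 12) z.
have map_idx : map (nth 0 w) idx = map s live'.
  by rewrite def_l' map_runs -sz_w -/(mkseq _ _) mkseq_nth.
have sz_idx : size idx = size live' by rewrite -(size_map (nth 0 w)) map_idx size_map.
have live'P x : s x < 4 -> x \in live'.
  by move=> ltx; rewrite mem_rotr mem_filter ltx mem_enum.
have [r rP] : exists r : 'I_n, forall x y, x \in live' -> y \in live' ->
    cyc_pos r x <= cyc_pos r y -> index x live' <= index y live'.
  have pw : pairwise (fun a b : 'I_n => a < b) (live s).
    rewrite -sorted_pairwise; last by move=> ? ? ?; apply: ltn_trans.
    apply: sorted_filter; first by move=> ? ? ?; apply: ltn_trans.
    have := iota_ltn_sorted 0 n; rewrite -val_enum_ord sorted_map.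
    exact.
  rewrite /live' /rotr /rot; move: (_ - _) => j.
  have := cat_take_drop j (live s).
  case: (drop j _) => [|r v]; move: (take j _) => u defl; rewrite -defl in pw.
    (* Without live elements any base point serves. *)
    rewrite cats0 in pw; case: u pw {defl} => [|r u] pw; first by exists (Ordinal n_gt0).
    exists r => x y; have := @rot_index_cyc_pos n [::] u r x y.
    by rewrite cats0; apply.
  by exists r => x y; apply: rot_index_cyc_pos.
exists r, w, (fun x => nth 0 idx (index x live')).
have idx_mem x : x \in live' -> index x live' < size idx by rewrite sz_idx index_mem.
do 5?split.
- move=> x y /live'P x_in /live'P y_in le_xy.
  apply: (sorted_leq_nth leq_trans leqnn 0 (sorted_runs _ (iota_ltn_sorted 0 12)));
    rewrite ?inE ?idx_mem //.
  exact: rP.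
- rewrite sz_w; have : all (ltn^~ 12) idx by apply: all_runs.
  by move=> /(all_nthP 0); apply; apply/idx_mem/live'P.
- by rewrite -(nth_map 0 0) ?idx_mem ?live'P // map_idx (nth_map x) ?index_mem ?nth_index // live'P.
- by move: w_in; rewrite sz_w !inE => /orP[]/eqP-> [|[|[|[|[|[|[|[|[|[|[|[|j]]]]]]]]]]]].
- by move: w_in; rewrite !inE => /orP[]/eqP->.
- by move: w_in; rewrite !inE => /orP[]/eqP-> [|[|[|i]]].
- by move: w_in; rewrite !inE => /orP[]/eqP->.
Qed.

(** * Volumes *)

(** [ball2 r] and [ball3 r] are the sums of ['C(r, i)] for [i] up to 2 and 3, in the form given by
    Pascal's rule. *)
Fixpoint ball2 (r : nat) : nat := if r is r'.+1 then ball2 r' + r'.+1 else 1.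
Fixpoint ball3 (r : nat) : nat := if r is r'.+1 then ball3 r' + ball2 r' else 1.

(** Berlekamp's volume: an element of level [i] counts the ways to place at most [3 - i] more lies
    in [r] answers. *)
Definition volume (r a0 a1 a2 a3 : nat) : nat :=
  a0 * ball3 r + a1 * ball2 r + a2 * r.+1 + a3.

Lemma ball_mono r : r < ball2 r <= ball3 r.
Proof. by elim: r => //= r; lia. Qed.

Lemma ball3_exp2 r : ball3 r <= 2 ^ r.
Proof. by elim: r => //= r IHr; rewrite expnS; have := ball_mono r; lia. Qed.

Lemma ball3_cube r : ball3 r <= r.+1 ^ 3.
Proof.
have square k : ball2 k <= k.+1 * k.+1 by elim: k => //= k; nia.
elim: r => //= r; have := square r; rewrite !expnS expn0; nia.
Qed.

Lemma leq_ball3 r r' : r <= r' -> ball3 r <= ball3 r'.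
Proof.
by move=> /subnK<-; elim: (r' - r) => //= k IHk; apply: leq_trans IHk (leq_addr _ _).
Qed.

Lemma sum_bin_ball3 q : \sum_(i < 4) 'C(q, i) = ball3 q.
Proof.
have ball2E k : ball2 k = 1 + k + 'C(k, 2).
  by elim: k => //= k ->; rewrite binS bin1; lia.
rewrite !big_ord_recr big_ord0 /= bin0 bin1.
elim: q => // q IHq.
by rewrite /= -IHq ball2E !binS bin1; lia.
Qed.

(** Vandermonde: the lies are sorted by their number among the first [m] answers. The right side is
    the volume after [m] exact halvings. *)
Lemma ball3D m n : ball3 (m + n) = volume n 1 m 'C(m, 2) 'C(m, 3).
Proof.
rewrite /volume; elim: m n => [|m IHm] n; first by rewrite add0n !bin0n /=; lia.
by rewrite addSnnS IHm /= !binS !bin1; nia.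
Qed.

(** Apart from level 3, the yes side weighs at least as much as the no side and at most [2 ^ r];
    elements of level 3 are added to it to equalize the volumes. *)
Lemma isolated_wins r a0 a1 a2 a3 :
  a0 + a1 + a2 <= 1 -> volume r a0 a1 a2 a3 <= 2 ^ r -> winning_type r a0 a1 a2 a3.
Proof.
elim: r a0 a1 a2 a3 => [|r IHr] a0 a1 a2 a3 le1.
  by rewrite /volume /= => ?; apply: winning_type0; lia.
rewrite /volume /= expnS => le_vol.
have mono := ball_mono r; have exp2 := ball3_exp2 r.
have : a0 * ball2 r + a1 * r.+1 + a2 <= a0 * ball3 r + a1 * ball2 r + a2 * r.+1 <= 2 ^ r.
  by case: a0 a1 a2 le1 {le_vol} => [|[|?]] [|[|?]] [|[|?]] //= _; lia.
set Ln := (X in X <= _ <= _); set Ly := (X in _ <= X <= _) => /andP[le_L le_Ly].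
have le_T : Ly + Ln + a3 <= 2 * 2 ^ r by rewrite /Ly /Ln; nia.
(* Truncated subtraction: if [Ly] alone reaches half of the volume, all of level 3 stays outside the
   question. *)
pose t3 := (Ly + Ln + a3) %/ 2 - Ly.
have le_t3 : t3 <= a3 by rewrite /t3; lia.
apply: (@winning_type_question _ _ _ _ _ a0 a1 a2 t3).
- by move=> l shl nl; apply: isolating_question nl le1 le_t3.
- rewrite !subnn !addn0; apply: IHr => //.
  by rewrite /volume -/Ly /t3; lia.
rewrite !subnn !add0n; apply: IHr; first lia.
by rewrite /volume mul0n add0n; move: le_t3; rewrite /t3 /Ln; lia.
Qed.

(* [K] bounds the imbalance caused by rounding on the levels below 3, and [N] measures
   the supply of elements of level 3; each question halves [N]. *)
Definition wins_from (K r N : nat) (P : nat -> nat -> nat -> Prop) : Prop :=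
  forall a0 a1 a2 a3, P a0 a1 a2 -> N <= a3 + K -> volume r a0 a1 a2 a3 <= 2 ^ r ->
  winning_type r a0 a1 a2 a3.

(** The element of level 0 contributes [ball3 r - ball2 r] to the difference, an odd element of
    level 1 at most [ball2 r - r.+1], one of level 2 at most [r]. Together this is [ball3 r - 1]. *)
Lemma balancing r a0 a1 a2 t1 t2 :
  a0 <= 1 -> halved a1 t1 -> halved a2 t2 ->
  let Ly := a0 * ball3 r + t1 * ball2 r + (t2 + (a1 - t1)) * r.+1 + (a2 - t2) in
  let Ln := (a1 - t1 + a0) * ball2 r + (a2 - t2 + t1) * r.+1 + t2 in
  Ly < Ln + ball3 r /\ Ln < Ly + ball3 r.
Proof.
rewrite /halved => le_a0 h1 h2.
have [u1 [-> d1]] : exists u1, a1 = t1 + u1 /\ [|| u1 == t1, u1 == t1.+1 | t1 == u1.+1].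
  by exists (a1 - t1); lia.
have [u2 [-> d2]] : exists u2, a2 = t2 + u2 /\ [|| u2 == t2, u2 == t2.+1 | t2 == u2.+1].
  by exists (a2 - t2); lia.
rewrite !addKn; have mono := ball_mono r.
have [->|->] : a0 = 0 \/ a0 = 1 by lia.
all: by case/or3P: d1 => /eqP->; case/or3P: d2 => /eqP->; nia.
Qed.

(** The [t3] equalizing the volumes is within [K / 2] of half of [a3], hence between the thirds
    since [a3] is at least [7 * K]. Either answer keeps at least [(a3 - K) / 2] elements on level 3,
    which restores the supply bound with [N]. *)
Lemma balanced_step K r N a0 a1 a2 a3 t1 t2 :
  a0 <= 1 -> halved a1 t1 -> halved a2 t2 -> ball3 r <= K -> 4 * K <= N ->
  2 * N <= a3 + K -> volume r.+1 a0 a1 a2 a3 <= 2 ^ r.+1 ->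
  (forall b3, N <= b3 + K -> volume r a0 t1 (t2 + (a1 - t1)) b3 <= 2 ^ r ->
     winning_type r a0 t1 (t2 + (a1 - t1)) b3) ->
  (forall b3, N <= b3 + K -> volume r 0 (a1 - t1 + a0) (a2 - t2 + t1) b3 <= 2 ^ r ->
     winning_type r 0 (a1 - t1 + a0) (a2 - t2 + t1) b3) ->
  winning_type r.+1 a0 a1 a2 a3.
Proof.
move=> le_a0 h1 h2 le_K le_N le_a3 le_vol win_yes win_no.
have [] := balancing r le_a0 h1 h2.
set Ly := (X in X < _); set Ln := (X in _ < X + _) => ltL gtL.
have le_t1 : t1 <= a1 by move: h1; rewrite /halved; lia.
have le_t2 : t2 <= a2 by move: h2; rewrite /halved; lia.
have T_eq : volume r.+1 a0 a1 a2 a3 = Ly + Ln + a3.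
  rewrite /volume /Ly /Ln /= -{1}(subnKC le_t1) -{1}(subnKC le_t2).
  by move: (a1 - t1) (a2 - t2) => u1 u2; nia.
rewrite T_eq expnS in le_vol.
pose t3 := (Ly + Ln + a3) %/ 2 - Ly.
have [lo_t3 hi_t3] : a3 <= 2 * t3 + K /\ 2 * t3 <= a3 + K by rewrite /t3; lia.
apply: (@winning_type_question _ _ _ _ _ a0 t1 t2 t3).
- by move=> l shl nl; apply: balanced_question nl _ _ _ _ _ => //; lia.
- rewrite subnn addn0; apply: win_yes; first lia.
  have -> : volume r a0 t1 (t2 + (a1 - t1)) (t3 + (a2 - t2)) = Ly + t3.
    by rewrite /volume /Ly; lia.
  by rewrite /t3; lia.
rewrite subnn; apply: win_no; first lia.
have -> : volume r 0 (a1 - t1 + a0) (a2 - t2 + t1) (a3 - t3 + t2) = Ln + (a3 - t3).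
  by rewrite /volume /Ln; lia.
by rewrite /t3; lia.
Qed.

(** * The strategy *)

Lemma stage_step K r N (P Q : nat -> nat -> nat -> Prop) :
  ball3 r <= K -> 4 * K <= N ->
  (forall a0 a1 a2, P a0 a1 a2 -> exists t1 t2,
     [/\ a0 <= 1, halved a1 t1, halved a2 t2,
         Q a0 t1 (t2 + (a1 - t1)) & Q 0 (a1 - t1 + a0) (a2 - t2 + t1)]) ->
  wins_from K r N Q -> wins_from K r.+1 (2 * N) P.
Proof.
move=> le_K le_N PQ winQ a0 a1 a2 a3 /PQ[t1 [t2 [le_a0 h1 h2 Qy Qn]]] le_a3 le_vol.
by apply: (balanced_step le_a0 h1 h2 le_K le_N le_a3 le_vol) => b3;
  apply: winQ.
Qed.

(* [s] is the number of questions left in the stage, in which level 1 (stage 1) resp.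
   level 2 (stage 2) is exhausted by halving. *)
Definition stage2 s (a0 a1 a2 : nat) : Prop :=
  a0 + a1 <= 1 /\ a2 + 2 * a0 + a1 <= 2 ^ s + 1.

(** [y] measures level 2 in units of [2 ^ s]. Halving preserves it, and the inflow from level 1 adds
    about one unit per question. *)
Definition stage1 s y (a0 a1 a2 : nat) : Prop :=
  [/\ a0 <= 1, a1 + 2 * a0 <= 2 ^ s + 1 & a2 <= 2 ^ s * y + 3].

(** The yes side keeps the element of level 0, if any, and then receives the smaller half of level
    1. *)
Definition rounded (a0 a1 : nat) : nat := if a0 == 0 then a1.+1 %/ 2 else a1 %/ 2.

(** After [s] questions level 2 has at most two elements. Two more leave at most one element below
    level 3, and [isolated_wins] takes over. *)
Lemma stage2_wins K r s : ball3 (r + s.+2) <= K ->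
  wins_from K (r + s.+2) (4 * K * 2 ^ s.+2) (stage2 s).
Proof.
elim: s => [|s IHs] le_K.
  have le_r1 : ball3 r.+1 <= K by apply: leq_trans (leq_ball3 _) le_K; lia.
  have le_r0 : ball3 r <= K by apply: leq_trans (leq_ball3 _) le_r1; lia.
  rewrite addn2 (_ : 4 * K * 2 ^ 2 = 2 * (2 * (4 * K))); last lia.
  pose P a0 a1 a2 := [/\ a0 + a1 <= 1, a0 + a1 = 0 \/ a2 = 0 & a2 <= 2].
  apply: (@stage_step _ _ _ _ P) => //; first lia.
    rewrite /stage2 => a0 a1 a2 [le1 le2]; exists (rounded a0 a1), (a2 %/ 2).
    by rewrite /P /rounded /halved; case: eqP => ? /=; split; try split; lia.
  apply: (@stage_step _ _ _ _ (fun a0 a1 a2 => a0 + a1 + a2 <= 1)) => //.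
    rewrite /P => a0 a1 a2 [le1 le2 le3]; exists (rounded a0 a1), (a2 %/ 2).
    by rewrite /rounded /halved; case: eqP => ? /=; split; lia.
  by move=> a0 a1 a2 a3 le1 _; apply: isolated_wins.
rewrite addnS expnS (_ : 4 * K * (2 * _) = 2 * (4 * K * 2 ^ s.+2)); last lia.
apply: (@stage_step _ _ _ _ (stage2 s)); last 1 first.
- by apply: IHs; apply: leq_trans (leq_ball3 _) le_K; lia.
- by apply: leq_trans (leq_ball3 _) le_K; lia.
- by rewrite leq_pmulr // expn_gt0.
rewrite /stage2 expnS => a0 a1 a2 [le1 le2]; exists (rounded a0 a1), (a2 %/ 2).
by rewrite /rounded /halved; case: eqP => ? /=; split; try split; lia.
Qed.

(** After [s] questions level 2 has at most [y + s + 3] elements, and one more question leads into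
    [stage2 S]. *)
Lemma stage1_wins K r S s y : ball3 (r + (S + s).+3) <= K -> y + s + 9 <= 2 ^ S ->
  wins_from K (r + (S + s).+3) (4 * K * 2 ^ (S + s).+3) (stage1 s y).
Proof.
elim: s y => [|s IHs] y le_K le_y.
  rewrite addn0 addnS expnS (_ : 4 * K * (2 * _) = 2 * (4 * K * 2 ^ S.+2)); last lia.
  apply: (@stage_step _ _ _ _ (stage2 S)); last 1 first.
  - by apply: stage2_wins; apply: leq_trans (leq_ball3 _) le_K; lia.
  - by apply: leq_trans (leq_ball3 _) le_K; lia.
  - by rewrite leq_pmulr // expn_gt0.
  rewrite /stage1 /stage2 => a0 a1 a2 [le0 le1 le2]; exists (rounded a0 a1), (a2 %/ 2).
  by rewrite /rounded /halved; case: eqP => ? /=; split; try split; lia.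
rewrite [S + _]addnS [r + _]addnS expnS.
rewrite (_ : 4 * K * (2 * _) = 2 * (4 * K * 2 ^ (S + s).+3)); last lia.
apply: (@stage_step _ _ _ _ (stage1 s y.+1)); last 1 first.
- by apply: IHs; [apply: leq_trans (leq_ball3 _) le_K; lia | lia].
- by apply: leq_trans (leq_ball3 _) le_K; lia.
- by rewrite leq_pmulr // expn_gt0.
rewrite /stage1 expnS => a0 a1 a2 [le0 le1 le2]; exists (rounded a0 a1), (a2 %/ 2).
have le2' : a2 <= 2 * (2 ^ s * y) + 3 by rewrite mulnA.
have e2 : 2 ^ s * y.+1 = 2 ^ s * y + 2 ^ s by rewrite mulnS addnC.
rewrite e2; move: (2 ^ s * y) le2' {le2 e2} => z le2.
by rewrite /rounded /halved; case: eqP => ? /=; split; try split; lia.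
Qed.

(** [d] counts the exact halvings still to come. Before each of them all level sizes are even, and
    by Pascal's rule both answers give the same sizes. *)
Lemma halving_wins m n d : d <= m ->
  winning_type n 1 m 'C(m, 2) 'C(m, 3) ->
  winning_type (n + d) (2 ^ d) (2 ^ d * (m - d)) (2 ^ d * 'C(m - d, 2)) (2 ^ d * 'C(m - d, 3)).
Proof.
move=> le_d win; elim: d le_d => [|d IHd] le_d; first by rewrite addn0 subn0 !mul1n.
rewrite addnS; move: (IHd (ltnW le_d)); rewrite -(subnSK le_d).
move: (m - d.+1) => j.
rewrite expnS !binS !bin1; move: (2 ^ d) => p win'.
apply: (@winning_type_question _ _ _ _ _ p (p * j) (p * 'C(j, 2)) (p * 'C(j, 3))).
- move=> l shl nl; apply: balanced_question nl _ _ _ _ _ => //; rewrite /halved; lia.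
- by move: win'; congr winning_type; lia.
by move: win'; congr winning_type; lia.
Qed.

(** * Parameters for large [m] *)

Lemma large_exponent S : 40 <= S -> exists2 u, 4 * S + 1 <= 2 ^ u & 3 * u + 14 <= S.
Proof.
move=> ge_S; exists (8 + (S - 40) %/ 3); last lia.
have : (S - 40) %/ 3 < 2 ^ ((S - 40) %/ 3) by apply: ltn_expl.
rewrite expnD (_ : 2 ^ 8 = 256) //; lia.
Qed.

Lemma leq_mul_bin3 m p : p + 2 <= m -> p ^ 3 <= 'C(m, 3) * 6.
Proof.
move=> le_m; have := bin_ffact m 3; rewrite (_ : 3`! = 6) // => ->.
rewrite !ffactnS ffactn0 muln1 !expnS expn0 muln1.
by apply: leq_mul; [lia | apply: leq_mul; lia].
Qed.

(** The two stages take [2 * S + 5] questions. With [K = 2 ^ (3 * u)] they consume a supply of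
    [2 ^ (3 * u + 2 * S + 7)], at most [2 ^ (3 * S - 6)] and so at most ['C(m, 3)]. *)
Lemma phase2_wins m n S : 40 <= S -> 2 ^ S <= m < 2 ^ S.+1 ->
  n <= 4 * S.+1 -> ball3 (m + n) <= 2 ^ n ->
  winning_type n 1 m 'C(m, 2) 'C(m, 3).
Proof.
move=> ge_S /andP[ge_m lt_m] le_n; rewrite ball3D => le_vol.
have [|u le_u le_uS] := @large_exponent S.+1; first lia.
have bin3 : 2 ^ (3 * S - 6) <= 'C(m, 3).
  rewrite -(leq_pmul2r (isT : 0 < 6)).
  apply: leq_trans (leq_mul_bin3 (p := 2 ^ S.-1) _).
    rewrite -expnM (_ : S.-1 * 3 = (3 * S - 6) + 3); last lia.
    by rewrite expnD leq_mul2l orbT.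
  move: ge_m; rewrite -{1}(prednK (_ : 0 < S)) ?expnS; last lia.
  have : 2 < 2 ^ S.-1 by rewrite (@ltn_exp2l 2 1); lia.
  lia.
have K_le : ball3 n <= 2 ^ (3 * u).
  apply: leq_trans (leq_ball3 le_n) _; apply: leq_trans (ball3_cube _) _.
  by rewrite [3 * u]mulnC expnM leq_exp2r // -addn1.
(* Each element of level 3 has volume 1, so ['C(m, 3)] is at most [2 ^ n]. *)
have ge_n : 3 * S - 6 <= n.
  rewrite -(leq_exp2l _ _ (isT : 1 < 2)); apply: leq_trans bin3 _.
  by apply: leq_trans le_vol; rewrite /volume; lia.
have -> : n = (n - (S.+1 + S.+1).+3) + (S.+1 + S.+1).+3 by lia.
apply: (@stage1_wins (2 ^ (3 * u)) _ S.+1 S.+1 (2 ^ S)).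
- by rewrite subnK //; lia.
- rewrite expnS; have : 2 ^ 6 * 2 ^ (S - 6) = 2 ^ S by rewrite -expnD; congr (2 ^ _); lia.
  have := ltn_expl (S - 6) (isT : 1 < 2).
  rewrite (_ : 2 ^ 6 = 64) //; lia.
- split=> //; first by move: lt_m; lia.
  apply: leq_trans (leq_addr _ _).
  have := bin_ffact m 2; rewrite (_ : 2`! = 2) // !ffactnS ffactn0 muln1.
  move: lt_m; rewrite expnS; move: (2 ^ S) => p lt_m; nia.
- rewrite -mulnA -expnD -[4]/(2 ^ 2) -expnD.
  by apply: leq_trans (leq_trans _ bin3) (leq_addr _ _); rewrite leq_exp2l //; lia.
by rewrite subnK //; lia.
Qed.

Lemma levels_init n : levels (init_state n) = nseq n 0.
Proof.
rewrite /levels /live; have -> : [seq x <- enum 'I_n | init_state n x < 4] = enum 'I_n.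
  by apply/all_filterP/allP => x _; rewrite ffunE.
apply: (@eq_from_nth _ 0); rewrite size_map size_enum_ord ?size_nseq // => i lt_i.
by rewrite (nth_map (Ordinal lt_i)) ?size_enum_ord // ffunE nth_nseq lt_i.
Qed.

Theorem theorem2 :
  exists m0 : nat, forall m : nat, m0 <= m ->
    exists (q : nat) (t : strategy (2 ^ m)),
      [/\ is_Nmin m q,
          complete_of_depth q t,
          winning t,
          all_questions (@four_interval_question (2 ^ m)) t
        & all_states (@well_shaped (2 ^ m)) (init_state (2 ^ m)) t].
Proof.
exists (2 ^ 40) => m ge_m.
have m_gt0 : 0 < m by apply: leq_trans ge_m; rewrite expn_gt0.
pose S := trunc_log 2 m.
have ge_S : 40 <= S by apply: trunc_log_max.
have m_bounds : 2 ^ S <= m < 2 ^ S.+1 by apply: trunc_log_bounds.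
have volP q : reflect (volume_ok m q) (2 ^ m * ball3 q <= 2 ^ q).
  by rewrite -sum_bin_ball3; apply: idP.
(* Bounds the least [q] by [m + 4 * S.+1]: the cube of [2 ^ S.+2] is at most [2 ^ (4 * S.+1)]. *)
have ok4 : 2 ^ m * ball3 (m + 4 * S.+1) <= 2 ^ (m + 4 * S.+1).
  rewrite expnD leq_mul2l; apply/orP; right.
  apply: leq_trans (ball3_cube _) _.
  apply: (@leq_trans ((2 ^ S.+2) ^ 3)); last by rewrite -expnM leq_exp2l //; lia.
  rewrite leq_exp2r // expnS.
  have [|u le_u le_uS] := @large_exponent S.+1; first lia.
  have : 2 ^ u <= 2 ^ S.+1 by rewrite leq_exp2l //; lia.
  lia.
have exq : exists q, 2 ^ m * ball3 q <= 2 ^ q by exists (m + 4 * S.+1).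
case: (ex_minnP exq) => q ok_q min_q.
have le_mq : m <= q.
  rewrite -(leq_exp2l _ _ (isT : 1 < 2)); apply: leq_trans ok_q.
  by rewrite leq_pmulr //; have := ball_mono q; lia.
have win : winning_type (q - m) 1 m 'C(m, 2) 'C(m, 3).
  apply: (phase2_wins ge_S m_bounds).
    by have := min_q _ ok4; lia.
  rewrite subnKC // -(leq_pmul2l (_ : 0 < 2 ^ m)) ?expn_gt0 //.
  by rewrite -expnD subnKC.
(* With [d = m] the level sizes are those of the initial state. *)
have := halving_wins (leqnn m) win; rewrite subnK // subnn !bin0n !muln0 => win0.
have [||t [ct lt qt st]] := @strategy_of_wins (2 ^ m) q (init_state _).
- by move=> s'; apply: shaped_well_shaped; rewrite expn_gt0.
- rewrite levels_init; apply: win0; last by split; rewrite count_nseq ?mul1n.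
  exists arcs, (2 ^ m :: nseq 9 0); split=> //.
  by rewrite /= !cats0; apply: cyc_refl.
exists q, t; split=> //; split; first exact/volP.
by move=> q' /volP/min_q.
Qed.
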